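(* Let $k, N, L$ be integers with $1 \le L \le k \le N$. Let $M_{k-L+1}$ be the $L$-th largest element of a uniformly random $k$-element subset of $\{1,\dots,N\}$. Then $$\mathbb{E}[M_{k-L+1}] = (N+1)\,\frac{k-L+1}{k+1}.$$
   Context: $k$ tanks are observed, drawn uniformly without replacement from tanks numbered $1,\dots,N$, i.e. every $k$-element subset of $\{1,\dots,N\}$ is equally likely. *)

(* Defs.v *)
From HB Require Import structures.
From mathcomp Require Import all_boot all_order all_algebra.
From mathcomp Require Import all_classical all_reals all_analysis.

Set Implicit Arguments.
Unset Strict Implicit.
Unset Printing Implicit Defensive.

Import Order.TTheory GRing.Theory Num.Theory.

Local Open Scope classical_set_scope.
Local Open Scope ring_scope.

(* The ordinal i : 'I_N (counted from 0) stands for the tank numbered i + 1,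
   so that 'I_N represents {1, ..., N}. *)
Definition tank_number (N : nat) (i : 'I_N) : nat := i.+1.

(* The L-th largest tank number in A, with L counted from 1 (L = 1 is the
   maximum); the default value 0 is never reached when 1 <= L <= #|A|. *)
Definition nth_largest (N : nat) (L : nat) (A : {set 'I_N}) : nat :=
  nth 0%N (sort geq [seq tank_number i | i in A]) L.-1.

(* S is a random k-element subset of 'I_N, all of them equally likely. The
   measurability clause says that S is measurable for the discrete
   sigma-algebra on the finite type {set 'I_N}. *)
Definition uniform_subset d (T : measurableType d) (R : realType)
    (P : probability T R) (N k : nat) (S : T -> {set 'I_N}) : Prop :=
  forall A : {set 'I_N},
    measurable (S @^-1` [set A]) /\
    P (S @^-1` [set A]) =
      (if #|A| == k then ('C(N, k)%:R^-1)%:E else 0%E).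

(* Main.v *)
Require Import Defs.
From HB Require Import structures.
From mathcomp Require Import all_boot all_order all_algebra.
From mathcomp Require Import all_classical all_reals all_analysis.
From mathcomp Require Import measurable_realfun.
From mathcomp Require Import ring.

Set Implicit Arguments.
Unset Strict Implicit.
Unset Printing Implicit Defensive.

Import Order.TTheory GRing.Theory Num.Theory.

Local Open Scope ring_scope.

(** Since all k-element subsets are equally likely, the expectation is the sum
of the L-th largest element over all of them, divided by 'C(N, k)
([expectation_uniform_subset]). That sum has the closed form
  (k - L + 1) * 'C(N + 1, k + 1)                   ([sum_nth_largest]),
and (k + 1) * 'C(N + 1, k + 1) = (N + 1) * 'C(N, k) turns the quotient into
(N + 1) (k - L + 1) / (k + 1).

The closed form is Pascal's rule for 'C(N + 2, k + 1), by induction on the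
number of tanks. A k-element subset of {1, ..., N + 1} either omits N + 1, and
is a k-element subset of {1, ..., N}, or contains it. In the latter case its
largest element is N + 1, and its L-th largest element, for L > 1, is the
(L - 1)-th largest element of a (k - 1)-element subset of {1, ..., N}. The
weight k - L + 1 is the same for (k, L) and (k - 1, L - 1), so the two terms
of Pascal's rule can be added. For L = 1 the second term is
(N + 1) * 'C(N, k - 1) = k * 'C(N + 1, k), which again has the weight k. *)

Definition sorted_tanks (N : nat) (A : {set 'I_N}) : seq nat :=
  sort geq [seq tank_number i | i in A].

Definition widen_set (N : nat) (B : {set 'I_N}) : {set 'I_N.+1} :=
  lift ord_max @: B.

Lemma ord_max_notin_widen_set (N : nat) (B : {set 'I_N}) :
  ord_max \notin widen_set B.
Proof. by apply/imsetP => -[i _] /eqP; rewrite (negbTE (neq_lift _ _)). Qed.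

Lemma card_widen_set (N : nat) (B : {set 'I_N}) : #|widen_set B| = #|B|.
Proof. exact/card_imset/lift_inj. Qed.

Lemma mem_widen_set (N : nat) (B : {set 'I_N}) (i : 'I_N) :
  (lift ord_max i \in widen_set B) = (i \in B).
Proof. by rewrite mem_imset //; exact: lift_inj. Qed.

Lemma widen_setK (N : nat) (B : {set 'I_N}) :
  lift ord_max @^-1: widen_set B = B.
Proof. by apply/setP => i; rewrite inE mem_widen_set. Qed.

Lemma preimset_liftK (N : nat) (A : {set 'I_N.+1}) :
  widen_set (lift ord_max @^-1: A) = A :\ ord_max.
Proof.
apply/setP => i; rewrite in_setD1.
case: (unliftP ord_max i) => [j|] ->{i}.
  by rewrite mem_widen_set inE eq_sym neq_lift.
by rewrite eqxx (negbTE (ord_max_notin_widen_set _)).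
Qed.

(** The subsets of 'I_N.+1 that omit [ord_max] are the [widen_set B]; those that
contain it are the [ord_max |: widen_set B]. The preimage under
[lift ord_max] recovers [B] in both cases. *)
Lemma big_set_ord_recr (N k : nat) (F : {set 'I_N.+1} -> nat) :
  (\sum_(A : {set 'I_N.+1} | #|A| == k.+1) F A =
   \sum_(B : {set 'I_N} | #|B| == k.+1) F (widen_set B) +
   \sum_(B : {set 'I_N} | #|B| == k) F (ord_max |: widen_set B))%N.
Proof.
rewrite (bigID (fun A : {set 'I_N.+1} => ord_max \in A)) /= addnC.
congr (_ + _)%N.
  rewrite (reindex_onto (@widen_set N) (fun A => lift ord_max @^-1: A)).
    apply: eq_bigl => B.
    by rewrite card_widen_set ord_max_notin_widen_set widen_setK eqxx !andbT.
  move=> A /andP[_ maxA]; rewrite preimset_liftK; apply/setP => i.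
  by rewrite !inE; case: eqP => // ->; rewrite (negbTE maxA).
rewrite (reindex_onto (fun B => ord_max |: widen_set B)
                      (fun A => lift ord_max @^-1: A)).
  apply: eq_bigl => B.
  rewrite cardsU1 ord_max_notin_widen_set card_widen_set add1n eqSS setU11 andbT.
  suff -> : lift ord_max @^-1: (ord_max |: widen_set B) = B by rewrite eqxx andbT.
  rewrite -[RHS]widen_setK; apply/setP => i.
  by rewrite !inE eq_sym (negbTE (neq_lift _ _)).
by move=> A /andP[_ maxA]; rewrite preimset_liftK finset.setD1K.
Qed.

Lemma geq_total : total geq.
Proof. by move=> m n; exact: leq_total. Qed.

Lemma geq_trans : transitive geq.
Proof. by move=> m n p nm /leq_trans; apply. Qed.

Lemma geq_anti : antisymmetric geq.
Proof. by move=> m n; rewrite andbC; exact: anti_leq. Qed.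

(** Only a permutation is claimed, because the order in which the elements of
[widen_set B] are enumerated does not matter once the list is sorted. *)
Lemma perm_tanks_widen_set (N : nat) (B : {set 'I_N}) :
  perm_eq [seq tank_number i | i in widen_set B] [seq tank_number i | i in B].
Proof.
have -> : [seq tank_number i | i in B] =
    [seq tank_number i | i <- [seq lift ord_max j | j in B]].
  by rewrite -map_comp; apply: eq_map => i; rewrite /comp /tank_number lift_max.
apply/perm_map/uniq_perm; rewrite ?enum_uniq //.
  by rewrite map_inj_uniq ?enum_uniq //; exact: lift_inj.
move=> i; rewrite mem_enum; apply/imsetP/mapP => -[j jB ->]; exists j => //.
  by rewrite mem_enum.
by rewrite mem_enum in jB.
Qed.

Lemma sorted_tanks_widen_set (N : nat) (B : {set 'I_N}) :
  sorted_tanks (widen_set B) = sorted_tanks B.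
Proof.
exact/(perm_sortP geq_total geq_trans geq_anti)/perm_tanks_widen_set.
Qed.

Lemma sorted_tanks_setU1 (N : nat) (B : {set 'I_N}) :
  sorted_tanks (ord_max |: widen_set B) = N.+1 :: sorted_tanks B.
Proof.
apply: (sorted_eq geq_trans geq_anti).
- exact: (sort_sorted geq_total).
- rewrite /= (path_sortedE geq_trans) (sort_sorted geq_total) andbT.
  apply/allP => m; rewrite mem_sort => /mapP[i _ ->].
  by rewrite /tank_number /= ltnS ltnW.
rewrite perm_sort perm_sym.
apply: perm_trans (_ : perm_eq _ (tank_number (@ord_max N) ::
    [seq tank_number i | i in widen_set B])) _.
  rewrite perm_cons perm_sort perm_sym; exact: perm_tanks_widen_set.
rewrite -map_cons; apply/perm_map; rewrite perm_sym.
apply/uniq_perm; rewrite ?enum_uniq //=.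
  by rewrite mem_enum ord_max_notin_widen_set enum_uniq.
by move=> i; rewrite !inE !mem_enum !inE.
Qed.

(** The index is [l = L - 1]. The identity holds for all [k] and [N]: when
[k <= l] or [N < k] both sides vanish, by the default value of [nth] and the
truncated subtraction in the first case, and because there is no such subset
in the second. The induction needs this generality, as it reaches [k = 0]. *)
Lemma sum_nth_largest (N k l : nat) :
  (\sum_(A : {set 'I_N} | #|A| == k) nth_largest l.+1 A =
   (k - l) * 'C(N.+1, k.+1))%N.
Proof.
elim: N k l => [|N IHN] [|k] l.
1,3: rewrite sub0n mul0n big1 // => A /eqP/cards0_eq ->;
  by rewrite /nth_largest /image_mem enum_set0 nth_nil.
  rewrite [in RHS]bin_small // muln0 big_pred0 // => A.
  by apply/negbTE; rewrite neq_ltn ltnS (leq_trans (max_card _)) ?card_ord.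
rewrite big_set_ord_recr.
(* Subsets omitting [ord_max] give the first term of Pascal's rule. *)
under eq_bigr => B _ do
  rewrite /nth_largest -/(sorted_tanks _) sorted_tanks_widen_set.
rewrite -/(nth_largest l.+1 _) IHN [in RHS]binS mulnDr; congr (_ + _)%N.
under eq_bigr => B _ do
  rewrite /nth_largest -/(sorted_tanks _) sorted_tanks_setU1.
(* For [l = 0] every subset containing [ord_max] contributes N.+1, and there are
   'C(N, k) of them. *)
case: l => [|l] /=; last by rewrite IHN subSS.
rewrite sum_nat_const subn0 -mul_bin_diag mulnC; congr (_ * _)%N.
rewrite -[X in 'C(X, k)](card_ord N) -card_draws.
by apply: eq_card => A; rewrite !inE.
Qed.

(** [f \o S] takes finitely many values, so it is the finite sum over [A] of
[f A] times the indicator of the event [S = A], which is integrated term by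
term; subsets of cardinality other than [k] have probability zero. *)
Lemma expectation_uniform_subset d (T : measurableType d) (R : realType)
    (P : probability T R) (N k : nat) (S : T -> {set 'I_N})
    (f : {set 'I_N} -> nat) :
  uniform_subset P k S ->
  ('E_P[fun w => (f (S w))%:R])%E =
    ((\sum_(A : {set 'I_N} | #|A| == k) f A)%:R / 'C(N, k)%:R)%:E.
Proof.
move=> unifS; rewrite unlock.
transitivity (\int[P]_w \sum_(A : {set 'I_N})
    ((f A)%:R%:E * (\1_(S @^-1` [set A]%classic) w)%:E))%E.
  apply: eq_integral => w _; rewrite (bigD1 (S w)) //= big1 => [|A ASw].
    by rewrite indicE mem_set // mule1 adde0.
  by rewrite indicE memNset ?mule0 // => /esym/eqP; rewrite (negbTE ASw).
have mS A : measurable (S @^-1` [set A]%classic) by case: (unifS A).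
rewrite ge0_integral_sum //=; last first.
  move=> A; apply/measurable_funeM/measurable_EFinP.
  exact: measurable_indic.
rewrite natr_sum mulr_suml -sumEFin [RHS]big_mkcond; apply: eq_bigr => A _.
have mindic : measurable_fun setT
    (fun w => (\1_(S @^-1` [set A]%classic) w)%:E : \bar R).
  exact/measurable_EFinP/measurable_indic.
rewrite ge0_integralZl_EFin //=.
rewrite integral_indic // setIT; have [_ PSA] := unifS A.
rewrite [X in (_ * X)%E]PSA.
by case: ifP => _; rewrite ?mule0 // EFinM.
Qed.

Theorem mainTheorem3 (R : realType) (d : measure_display)
    (T : measurableType d) (P : probability T R) (k N L : nat)
    (S : T -> {set 'I_N}) (hL : (1 <= L)%N) (hLk : (L <= k)%N)
    (hkN : (k <= N)%N) (hS : uniform_subset P k S) :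
  ('E_P[fun w => (nth_largest L (S w))%:R])%E =
    ((N%:R + 1) * ((k%:R - L%:R + 1) / (k%:R + 1)))%:E.
Proof.
rewrite (expectation_uniform_subset (nth_largest L) hS); congr (_%:E).
case: L hL hLk => // l _ lk; rewrite sum_nth_largest natrM natrB 1?ltnW //.
have bin0 : 'C(N, k)%:R != 0 :> R by rewrite pnatr_eq0 -lt0n bin_gt0.
have k0 : k%:R + 1 != 0 :> R by rewrite natr1 pnatr_eq0.
have diag : (N%:R + 1) * 'C(N, k)%:R = (k%:R + 1) * 'C(N.+1, k.+1)%:R :> R.
  by rewrite !natr1 -!natrM mul_bin_diag.
have -> : 'C(N.+1, k.+1)%:R = (N%:R + 1) * 'C(N, k)%:R / (k%:R + 1) :> R.
  by rewrite diag mulrC mulKf.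
rewrite -[l.+1%:R]natr1; field.
by rewrite bin0 k0.
Qed.
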